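(* Let $d\ge1$ and $p,q\ge0$ be integers. Then $F(z)=z^p\overline{z}^q-b_{p,q}(\mathbb{C}^d)$ gives a potential for $\operatorname{Hom}_{p,q}(\mathbb{C}^d)$, and for $m\ge1$, $F(z)=(z+\overline z)^m-2^mb_m(\mathbb{R}^{2d})=2^m\{(\operatorname{Re}z)^m-b_m(\mathbb{R}^{2d})\}$ gives a potential for $\operatorname{Hom}_m(\mathbb{C}^d)$. Here ''$F$ gives a potential for $P$'' means: for all unit vectors $v_1,\ldots,v_n\in\mathbb{C}^d$ and all real weights $w_1+\cdots+w_n=1$, $$\sum_{j=1}^n\sum_{k=1}^nw_jw_kF(\langle v_j,v_k\rangle)\ge0,$$ with equality if and only if $\int_{\mathbb{S}}f\,d\sigma=\sum_jw_jf(v_j)$ for all $f\in P$.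
   Context: $\langle z,w\rangle=\sum_iz_i\overline{w_i}$ on $\mathbb{C}^d$; $\mathbb{S}$ is the unit sphere of $\mathbb{C}^d$ with normalised surface measure $\sigma$. $\operatorname{Hom}_{p,q}(\mathbb{C}^d)$ is the space of polynomials on $\mathbb{C}^d$ that are homogeneous of degree $p$ in $z_1,\ldots,z_d$ and of degree $q$ in $\overline{z_1},\ldots,\overline{z_d}$; $\operatorname{Hom}_m(\mathbb{C}^d)$ is the space of homogeneous polynomials of degree $m$ in the real coordinates of $\mathbb{C}^d=\mathbb{R}^{2d}$. $b_{p,q}(\mathbb{C}^d)=\int_{\mathbb{S}}\int_{\mathbb{S}}\langle z,w\rangle^p\overline{\langle z,w\rangle}^q d\sigma(z)d\sigma(w)$, which is $0$ if $p\ne q$ and $\frac{(d-1)!p!}{(d-1+p)!}$ if $p=q$. $b_m(\mathbb{R}^{2d})$ is $0$ for $m$ odd and $\frac{1\cdot3\cdots(m-1)}{2d(2d+2)\cdots(2d+m-2)}$ for $m$ even. *)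

(* Defs.v *)
(* MathComp-Analysis (Lebesgue integral on a realType R)
   with complex numbers R[i] from mathcomp-real-closed. *)
From HB Require Import structures.
From mathcomp Require Import all_boot all_order all_algebra.
From mathcomp Require Import all_classical all_reals all_analysis.
From mathcomp.real_closed Require Import complex.

Set Implicit Arguments.
Unset Strict Implicit.
Unset Printing Implicit Defensive.

Import Order.TTheory GRing.Theory Num.Theory.
Local Open Scope ring_scope.
Local Open Scope complex_scope.

Section Defs.
Variable R : realType.
Local Notation C := R[i].

(* <z,w> = sum_i z_i conj(w_i) on C^d (vectors are row vectors 'rV[C]_d). *)
Definition cinner (d : nat) (z w : 'rV[C]_d) : C :=
  \sum_(i < d) z 0 i * (w 0 i)^*.

(* squared Euclidean norm of z in C^d = R^{2d}, as a real number *)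
Definition cnorm2 (d : nat) (z : 'rV[C]_d) : R := complex.Re (cinner z z).

(* indicator of the closed unit ball of C^d *)
Definition ball_ind (d : nat) (z : 'rV[C]_d) : R :=
  if cnorm2 z <= 1 then 1 else 0.

(* radial projection z / |z| (value at 0 is irrelevant: a null set) *)
Definition normalize (d : nat) (z : 'rV[C]_d) : 'rV[C]_d :=
  ((Num.sqrt (cnorm2 z))^-1)%:C *: z.

(* the vector of C^d whose coordinates are the first d entries of s *)
Definition vec_of_seq (d : nat) (s : seq C) : 'rV[C]_d :=
  \row_(i < d) nth 0 s i.

(* Iterated Lebesgue integral over C^k = R^{2k}: each complex coordinate
   x +i* y is integrated over R x R with Lebesgue measure.  By
   Fubini--Tonelli this is the Lebesgue integral on R^{2k} for the
   (bounded, compactly supported, measurable) integrands used below. *)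
Fixpoint iter_cint (k : nat) (g : seq C -> R) : R :=
  match k with
  | 0 => g [::]
  | k'.+1 =>
      Rintegral (@lebesgue_measure R) setT (fun x : R =>
        Rintegral (@lebesgue_measure R) setT (fun y : R =>
          iter_cint k' (fun s => g ((x +i* y) :: s))))
  end.

(* Real integral over the unit sphere S of C^d against the normalised surface
   measure sigma, via the cone-measure formula
     int_S h dsigma = (1/vol(B)) int_B h(x/|x|) dx. *)
Definition sphere_int_real (d : nat) (h : 'rV[C]_d -> R) : R :=
  iter_cint d (fun s => ball_ind (vec_of_seq d s) *
                        h (normalize (vec_of_seq d s)))
  / iter_cint d (fun s => ball_ind (vec_of_seq d s)).

(* complex-valued functions: integrate real and imaginary parts *)
Definition sphere_int (d : nat) (f : 'rV[C]_d -> C) : C :=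
  (sphere_int_real (fun z => complex.Re (f z)))
    +i* (sphere_int_real (fun z => complex.Im (f z))).

(* Hom_{p,q}(C^d): (complex) linear combinations of the monomials
   z_{a 0} ... z_{a (p-1)} conj(z_{b 0}) ... conj(z_{b (q-1)}). *)
Definition Hom_pq (d p q : nat) (f : 'rV[C]_d -> C) : Prop :=
  exists c : {ffun 'I_p -> 'I_d} -> {ffun 'I_q -> 'I_d} -> C,
    forall z : 'rV[C]_d,
      f z = \sum_(a : {ffun 'I_p -> 'I_d}) \sum_(b : {ffun 'I_q -> 'I_d})
              c a b * (\prod_(k < p) z 0 (a k)) * (\prod_(l < q) (z 0 (b l))^*).

(* the real coordinates of C^d = R^{2d}: (i,true) |-> Re z_i, (i,false) |-> Im z_i
   (returned as elements of C) *)
Definition real_coord (d : nat) (z : 'rV[C]_d) (r : 'I_d * bool) : C :=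
  if r.2 then 'Re (z 0 r.1) else 'Im (z 0 r.1).

(* Hom_m(C^d): homogeneous polynomials of degree m in the 2d real coordinates
   (with complex coefficients). *)
Definition Hom_m (d m : nat) (f : 'rV[C]_d -> C) : Prop :=
  exists c : {ffun 'I_m -> 'I_d * bool} -> C,
    forall z : 'rV[C]_d,
      f z = \sum_(a : {ffun 'I_m -> 'I_d * bool})
              c a * \prod_(k < m) real_coord z (a k).

(* b_{p,q}(C^d) *)
Definition b_pq (d p q : nat) : C :=
  if p == q then ((d.-1)`! * p`!)%:R / ((d.-1 + p)`!)%:R else 0.

(* b_m(R^{2d}) = 1*3*...*(m-1) / (2d(2d+2)...(2d+m-2)) for m even, 0 for m odd *)
Definition b_m (d m : nat) : C :=
  if odd m then 0
  else (\prod_(k < m./2) (2 * k + 1))%:R / (\prod_(k < m./2) (2 * d + 2 * k))%:R.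

(* "F gives a potential for P" *)
Definition gives_potential (d : nat) (F : C -> C) (P : ('rV[C]_d -> C) -> Prop)
  : Prop :=
  forall (n : nat) (v : 'I_n -> 'rV[C]_d) (w : 'I_n -> R),
    (forall j, cinner (v j) (v j) = 1) ->
    \sum_(j < n) w j = 1 ->
    let S := \sum_(j < n) \sum_(k < n)
               (w j)%:C * (w k)%:C * F (cinner (v j) (v k)) in
    0 <= S /\
    (S = 0 <-> (forall f, P f -> sphere_int f = \sum_(j < n) (w j)%:C * f (v j))).

End Defs.

(* Main.v *)
(* Writing <z,w>^p conj(<z,w>)^q (resp. (Re <z,w>)^m) as sum_a m_a(z) conj(m_a(w)), with m_a running
   over the monomials spanning the space P, the energy of (v_j, w_j) becomes a positive multiple of
   sum_a |sum_j w_j m_a(v_j) - int m_a dsigma|^2, as soon as the kernel z |-> K(z,v) integrates to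
   the constant b over the sphere for every unit vector v.

   That integral is computed from the rotation invariance of the iterated Lebesgue integral: a plane
   rotation is a product of three shears, and a shear is handled by Fubini and one-dimensional
   translation invariance.  Hence int (u.x)^m dsigma = c_m |u|^m; comparing the coefficients of t^2
   for u = e_0 + t e_j and summing over j gives (n + m - 2) c_m = (m - 1) c_(m-2).  The mixed complex
   moments are the coefficients of a |-> int (2 Re <z, a v>)^m dsigma = 2^m c_m on the unit circle. *)
Require Import Defs.
From HB Require Import structures.
From mathcomp Require Import all_boot all_order all_algebra.
From mathcomp Require Import all_classical all_reals all_analysis.
From mathcomp.real_closed Require Import complex.
From mathcomp Require Import measurable_realfun ring lra zify.
Import Order.TTheory GRing.Theory Num.Theory.
Local Open Scope ring_scope.
Local Open Scope complex_scope.

Set Implicit Arguments.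
Unset Strict Implicit.

(** * Rotation invariance of plane integrals *)

Section PlaneIntegrals.
Context {R : realType}.
Notation mu := (@lebesgue_measure R).

(** Every integrability claim below reduces to this one: a bounded measurable function living on a
    set of finite measure. *)
Lemma le_indic_integrable {disp} {T : measurableType disp}
    (nu : {measure set T -> \bar R}) (f : T -> R) (A : set T) (M : R) :
  measurable A -> (nu A < +oo)%E -> measurable_fun setT f ->
  (forall x, `|f x| <= M * \1_A x) -> nu.-integrable setT (EFin \o f).
Proof.
move=> mA Afin mf fM.
apply: (@le_integrable _ _ _ nu setT measurableT _ (fun x => (M * \1_A x)%:E)).
- exact/measurable_EFinP.
- move=> x _ /=; rewrite lee_fin; exact: le_trans (fM x) (ler_norm _).
- under eq_fun do rewrite EFinM.
  apply: integrableZl => //.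
  apply/integrableP; split; first exact/measurable_EFinP.
  rewrite (eq_integral (fun x => (\1_A x)%:E)); last first.
    by move=> t _; rewrite gee0_abs// lee_fin.
  by rewrite integral_indic// setIT.
Qed.

Lemma lebesgue_measure_itvNfin (r : R) : (mu `[(- r)%R, r%R]%classic < +oo)%E.
Proof. by rewrite lebesgue_measure_itv; case: ifP => _; rewrite ?ltry. Qed.

(** Explicit bounds on a box are preferred to bare integrability because they survive iteration:
    integrating out one variable leaves a function bounded on a smaller-dimensional box. *)
Definition dom1 (M r : R) (f : R -> R) :=
  forall x, `|f x| <= if `|x| <= r then M else 0.

Lemma indic_itvN (M r x : R) :
  (if `|x| <= r then M else 0) = M * \1_(`[(- r), r]%classic) x.
Proof.
by rewrite indicE mem_setE in_itv/= -ler_norml; case: ifP; rewrite ?mulr1 ?mulr0.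
Qed.

Lemma dom1_integrable M r (f : R -> R) :
  measurable_fun setT f -> dom1 M r f -> mu.-integrable setT (EFin \o f).
Proof.
move=> mf fM; apply: (@le_indic_integrable _ _ mu f `[(- r), r]%classic M) => //.
  exact: lebesgue_measure_itvNfin.
by move=> x; rewrite -indic_itvN.
Qed.

Lemma Rintegral_itvN (M r : R) : 0 <= r ->
  Rintegral mu setT (fun x => if `|x| <= r then M else 0) = M * (r *+ 2).
Proof.
move=> r0; under eq_Rintegral do rewrite indic_itvN.
rewrite RintegralZl//; last first.
  apply: (@le_indic_integrable _ _ mu _ `[(- r), r]%classic 1) => //.
    exact: lebesgue_measure_itvNfin.
  by move=> x; rewrite mul1r ger0_norm.
congr (_ * _); rewrite /Rintegral integral_indic// setIT.
have E : (mu `[(- r)%R, r%R]%classic = if (- r < r)%R then (r - - r)%:E else 0)%E.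
  by rewrite lebesgue_measure_itv/= lte_fin.
rewrite -[LHS]/(fine (mu `[(- r)%R, r%R]%classic)) E.
case: ifPn => [_|] /=; first by rewrite opprK mulr2n.
rewrite -leNgt => rN.
by have -> : r = 0; [lra|rewrite mul0rn].
Qed.

Lemma dom1_Rintegral M r (f : R -> R) : 0 <= r ->
  measurable_fun setT f -> dom1 M r f -> `|Rintegral mu setT f| <= M * (r *+ 2).
Proof.
move=> r0 mf fM; apply: (le_trans (le_normr_Rintegral _ _)) => //.
  exact: dom1_integrable fM.
rewrite -Rintegral_itvN//; apply: le_Rintegral => //.
- apply: (@dom1_integrable M r) => //; first exact: measurableT_comp.
  by move=> x; rewrite normr_id.
- apply: (@dom1_integrable `|M| r).
    by under eq_fun do rewrite indic_itvN; exact: measurable_funM.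
  by move=> x; case: ifP => // _; rewrite normr0.
Qed.

(** The pushforward of Lebesgue measure under a translation agrees with it on half-open intervals,
    hence everywhere by uniqueness; the rest is the change of variables for a pushforward. *)
Lemma Rintegral_translate M r (f : R -> R) (a : R) :
  0 <= M -> measurable_fun setT f -> dom1 M r f ->
  Rintegral mu setT (fun x => f (x + a)) = Rintegral mu setT f.
Proof.
move=> M0 mf fM; congr fine.
have ms : measurable_fun [set: measurableTypeR R]
    ((fun x => x + a) : measurableTypeR R -> measurableTypeR R).
  exact: measurable_funD.
pose nu := measure_function_pushforward__canonical__measure_function_Measure mu ms.
have tinv : forall A, measurable A -> mu A = nu A.
  apply: lebesgue_measure_unique => _ [[b c] _ <-] /=.
  rewrite /pushforward.
  rewrite (_ : (_ @^-1` _)%classic = `](b - a), (c - a)]%classic); last first.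
    by apply/seteqP; split => x /=; rewrite !in_itv/= ltrBlDr lerBrDr.
  rewrite [LHS]lebesgue_measure_itv [RHS]lebesgue_measure_itv /= !lte_fin ltrD2r.
  by case: ifP => // _; rewrite -!EFinD; congr (_%:E); ring.
rewrite [RHS](eq_measure_integral nu);
  last by move=> A mA _; exact: tinv.
rewrite integral_pushforward//; first exact/measurable_EFinP.
rewrite preimage_setT.
apply: (@dom1_integrable M (r + `|a|)); first exact: measurableT_comp.
move=> x; apply: (le_trans (fM _)).
have nx : `|x| <= `|x + a| + `|a| by rewrite -{1}(addrK a x) ler_normB.
case: ifP => xa; case: ifP => xr //.
- by move: xr; rewrite (le_trans nx)// lerD2r.
Qed.

(** * Functions of two variables: Fubini, shears and rotations *)

Definition dom2 (M r : R) (G : R -> R -> R) :=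
  forall x y, `|G x y| <= if (`|x| <= r) && (`|y| <= r) then M else 0.

Definition meas2 (G : R -> R -> R) :=
  measurable_fun setT (fun z : measurableTypeR R * measurableTypeR R => G z.1 z.2).

Lemma meas2_app1 G x : meas2 G -> measurable_fun setT (G x).
Proof. by move=> mG; exact: (measurable_fun_pair2 x mG). Qed.

Lemma meas2_app2 G y : meas2 G -> measurable_fun setT (G^~ y).
Proof. by move=> mG; exact: (measurable_fun_pair1 y mG). Qed.

Lemma dom2_app1 M r G x : 0 <= M -> dom2 M r G -> dom1 M r (G x).
Proof. by move=> M0 + y => /(_ x y)/le_trans; apply; case: (`|x| <= r) (`|y| <= r) => -[]. Qed.

Lemma dom2_app2 M r G y : 0 <= M -> dom2 M r G -> dom1 M r (G^~ y).
Proof.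
by move=> M0 + x => /(_ x y)/le_trans; apply; case: (`|x| <= r) (`|y| <= r) => -[].
Qed.

Lemma Rintegral_swap M r G : 0 <= M -> meas2 G -> dom2 M r G ->
  Rintegral mu setT (fun x => Rintegral mu setT (fun y => G x y)) =
  Rintegral mu setT (fun y => Rintegral mu setT (fun x => G x y)).
Proof.
move=> M0 mG GM.
pose J := `[(- r), r]%classic.
pose f := fun z : measurableTypeR R * measurableTypeR R => G z.1 z.2.
have If : (mu \x mu)%E.-integrable setT (EFin \o f).
  apply: (@le_indic_integrable _ _ _ f (J `*` J)%classic M).
  - by apply: measurableX; exact: measurable_itv.
  - have : ((mu \x mu)%E (J `*` J)%classic < +oo)%E.
      rewrite product_measure1E; [|exact: measurable_itv..].
      rewrite lte_mul_pinfty//.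
        by rewrite ge0_fin_numE// lebesgue_measure_itvNfin.
      exact: lebesgue_measure_itvNfin.
    exact.
  - exact: mG.
  - move=> z; apply: le_trans (GM _ _) _.
    rewrite indicE in_setX !mem_setE !in_itv/= -!ler_norml.
    by case: ifP; rewrite ?mulr1 ?mulr0.
have := Fubini If; rewrite /f/= => FE.
rewrite /Rintegral.
(* The inner integrals are finite, so the truncation [fine] hidden in [Rintegral] loses nothing and
   Fubini for extended reals transfers. *)
have E1 x : (\int[mu]_y (G x y)%:E = (fine (\int[mu]_y (G x y)%:E))%:E)%E.
  rewrite fineK//; apply: integrable_fin_num => //.
  apply: (@dom1_integrable M r); [exact: meas2_app1|exact: dom2_app1].
have E2 y : (\int[mu]_x (G x y)%:E = (fine (\int[mu]_x (G x y)%:E))%:E)%E.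
  rewrite fineK//; apply: integrable_fin_num => //.
  apply: (@dom1_integrable M r); [exact: meas2_app2|exact: dom2_app2].
congr fine; under eq_integral do rewrite -E1.
by rewrite FE; apply: eq_integral => y _; rewrite -E2.
Qed.

Definition box_integrable2 (G : R -> R -> R) :=
  meas2 G /\ exists M r, 0 <= M /\ dom2 M r G.

Definition Rint2 (G : R -> R -> R) :=
  Rintegral mu setT (fun x => Rintegral mu setT (fun y => G x y)).

Lemma box_integrable2_shear a G : box_integrable2 G -> box_integrable2 (fun x y => G x (y + a * x)).
Proof.
move=> [mG [M [r [M0 GM]]]]; split.
  apply: (measurableT_comp (f := fun z => G z.1 z.2) mG
    (g := fun z : measurableTypeR R * measurableTypeR R => (z.1, z.2 + a * z.1))).
  apply: measurable_fun_pair => //.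
  by apply: measurable_funD => //; apply: measurable_funM.
(* If [|x| <= r] and [|y + a x| <= r], then [|y| <= r + |a| r]: the sheared support fits in this
   larger box. *)
exists M, (r + `|a| * r); split => // x y; apply: le_trans (GM _ _) _.
case: ifPn => [/andP[xr yr]|_]; last by case: ifP.
have r0 : 0 <= r by apply: le_trans xr.
rewrite ifT//; apply/andP; split.
  by rewrite (le_trans xr)// lerDl mulr_ge0.
rewrite -{1}(addrK (a * x) y) (le_trans (ler_normB _ _))// lerD// normrM.
by rewrite ler_wpM2l.
Qed.

Lemma box_integrable2_swap G : box_integrable2 G -> box_integrable2 (fun x y => G y x).
Proof.
move=> [mG [M [r [M0 GM]]]]; split.
  apply: (measurableT_comp (f := fun z => G z.1 z.2) mG
    (g := fun z : measurableTypeR R * measurableTypeR R => (z.2, z.1))).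
  exact: measurable_fun_pair.
by exists M, r; split => // x y; rewrite andbC; exact: GM.
Qed.

(** For fixed [x] the shear is a translation of the inner variable [y]. *)
Lemma Rint2_shear a G : box_integrable2 G -> Rint2 (fun x y => G x (y + a * x)) = Rint2 G.
Proof.
move=> [mG [M [r [M0 GM]]]]; apply: eq_Rintegral => x _.
apply: (@Rintegral_translate M r) => //; first exact: meas2_app1.
exact: dom2_app1.
Qed.

Lemma Rint2_swap G : box_integrable2 G -> Rint2 (fun x y => G y x) = Rint2 G.
Proof. by move=> [mG [M [r [M0 GM]]]]; rewrite [RHS](Rintegral_swap M0 mG GM). Qed.

Lemma box_integrable2_shear' a G : box_integrable2 G -> box_integrable2 (fun x y => G (x + a * y) y).
Proof. by move=> /box_integrable2_swap/(box_integrable2_shear a)/box_integrable2_swap. Qed.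

Lemma Rint2_shear' a G : box_integrable2 G -> Rint2 (fun x y => G (x + a * y) y) = Rint2 G.
Proof.
move=> nG; have nGs := box_integrable2_swap nG.
have /= <- := Rint2_swap (box_integrable2_shear' a nG).
by rewrite (Rint2_shear a nGs) (Rint2_swap nG).
Qed.

(* A rotation other than the half-turn is a product of three shears. *)
Lemma Rint2_rot c s G : c ^+ 2 + s ^+ 2 = 1 -> c != -1 -> box_integrable2 G ->
  Rint2 (fun x y => G (c * x - s * y) (s * x + c * y)) = Rint2 G.
Proof.
(* For an angle [t] with cosine [c] and sine [s], this is [-tan(t/2)]; the excluded half-turn is
   where it blows up. *)
move=> cs c1 nG; pose a := - s / (1 + c).
have c10 : 1 + c != 0 by rewrite addrC -(opprK 1) subr_eq0.
have aa : a * (1 + c) = - s by rewrite /a divfK.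
have as1 : 1 + a * s = c.
  apply: (mulfI c10); transitivity (1 + c + a * (1 + c) * s); first by ring.
  by rewrite aa -[1 in LHS]cs; ring.
(* The factorisation is horizontal by [a], vertical by [s], horizontal by [a] again. *)
rewrite -(Rint2_shear' a nG) -(Rint2_shear s (box_integrable2_shear' a nG)).
rewrite -(Rint2_shear' a (box_integrable2_shear s (box_integrable2_shear' a nG))).
congr Rint2; apply/funext => x; apply/funext => y; congr G.
- by rewrite -[in LHS]as1 -[s in - (s * y)]opprK -aa -as1; ring.
- by rewrite -[in LHS]as1; ring.
Qed.

End PlaneIntegrals.

(** * Iterated integrals over R^n *)

Section IteratedIntegrals.
Context {R : realType}.
Notation mu := (@lebesgue_measure R).
Implicit Types F H : seq R -> R.

Fixpoint iterint n F : R :=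
  if n is m.+1 then Rintegral mu setT (fun x => iterint m (fun s => F (x :: s)))
  else F [::].

(* Joint measurability in the first n coordinates, phrased through arbitrary
   measurable parametrisations so that no n-fold product space is needed. *)
Definition pmeas n F := forall disp (T : measurableType disp) (g : nat -> T -> R),
  (forall i, measurable_fun setT (g i)) ->
  measurable_fun setT (fun t => F (mkseq (g^~ t) n)).

Definition domn n (M r : R) F := forall s, size s = n ->
  `|F s| <= if all (fun x => `|x| <= r) s then M else 0.

Definition box_integrable n F := pmeas n F /\ exists M r, [/\ 0 <= M, 0 <= r & domn n M r F].

Lemma mkseq_cons {T : Type} (f : nat -> T) n :
  mkseq f n.+1 = f 0%N :: mkseq (fun i => f i.+1) n.
Proof. by rewrite /mkseq/= -[1%N]addn0 iotaDl -map_comp. Qed.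

Lemma mkseq_rcons {T : Type} (f : nat -> T) n :
  mkseq f n.+1 = rcons (mkseq f n) (f n).
Proof. by rewrite /mkseq -addn1 iotaD map_cat cats1. Qed.

Lemma eq_mkseq_lt {T : Type} (f g : nat -> T) n :
  (forall i, (i < n)%N -> f i = g i) -> mkseq f n = mkseq g n.
Proof.
by move=> fg; apply/eq_in_map => i; rewrite mem_iota add0n => /fg.
Qed.

Lemma pmeas_cons n F x : pmeas n.+1 F -> pmeas n (fun s => F (x :: s)).
Proof.
move=> mF disp T g mg.
have /= := mF disp T (fun i t => if i is j.+1 then g j t else x).
under eq_fun do rewrite mkseq_cons.
by apply; case.
Qed.

Lemma box_integrable_cons n F x : box_integrable n.+1 F -> box_integrable n (fun s => F (x :: s)).
Proof.
move=> [mF [M [r [M0 r0 FM]]]]; split; first exact: pmeas_cons.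
exists M, r; split => // s sn.
have := FM (x :: s); rewrite /= sn => /(_ erefl)/le_trans; apply.
by case: ifP => [/andP[_ ->]//|_]; case: ifP.
Qed.

(** Tonelli makes the integrals of the positive and negative parts measurable in the parameter, and
    the integral is their difference. *)
Lemma measurable_Rintegral_param {disp} {T : measurableType disp}
    (f : T * measurableTypeR R -> R) :
  measurable_fun setT f ->
  measurable_fun setT (fun t => Rintegral mu setT (fun x => f (t, x))).
Proof.
move=> mf; rewrite /Rintegral.
apply: (measurableT_comp (f := fine)) => //.
under eq_fun do rewrite integralE.
have mEf : measurable_fun setT (EFin \o f) by exact/measurable_EFinP.
apply: emeasurable_funB.
- rewrite (_ : (fun x => _) = fubini_F mu (EFin \o f)^\+%E).
    exact: (measurable_fun_fubini_tonelli_F _ (measurable_funepos mEf)).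
  apply/funext => t; apply: eq_integral => x _.
  by rewrite -[RHS]/(((EFin \o f)^\+ \o pair t) x)%E -funepos_comp.
- rewrite (_ : (fun x => _) = fubini_F mu (EFin \o f)^\-%E).
    exact: (measurable_fun_fubini_tonelli_F _ (measurable_funeneg mEf)).
  apply/funext => t; apply: eq_integral => x _.
  by rewrite -[RHS]/(((EFin \o f)^\- \o pair t) x)%E -funeneg_comp.
Qed.

Lemma pmeas_fun1 H s : pmeas (size s).+1 H -> measurable_fun setT (fun x => H (rcons s x)).
Proof.
move=> mH.
(* This parametrisation freezes the coordinates of [s] and lets only the last one vary. *)
have /= := mH _ (measurableTypeR R) (fun i t => if (i < size s)%N then nth 0 s i else t).
move=> h; rewrite (_ : (fun x => _) = fun t => H (mkseq
  (fun i => if (i < size s)%N then nth 0 s i else t) (size s).+1)).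
  by apply: h => i; case: (i < size s)%N.
apply/funext => x; rewrite mkseq_rcons ltnn; congr (H (rcons _ _)).
rewrite -[LHS](mkseq_nth 0).
by apply: eq_mkseq_lt => i ->.
Qed.

Lemma box_integrable_int_last n H : box_integrable n.+1 H ->
  box_integrable n (fun s => Rintegral mu setT (fun x => H (rcons s x))).
Proof.
move=> [mH [M [r [M0 r0 HM]]]]; split.
  move=> disp T g mg.
  apply: (@measurable_Rintegral_param _ T (fun z => H (rcons (mkseq (g^~ z.1) n) z.2))).
  have /= := mH _ (T * measurableTypeR R)%type
    (fun i z => if (i < n)%N then g i z.1 else z.2).
  move=> h; rewrite (_ : (fun z => _) = fun z : T * measurableTypeR R => H (mkseq
    (fun i => if (i < n)%N then g i z.1 else z.2) n.+1)).
    apply: h => i; case: (i < n)%N; last exact: measurable_snd.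
    exact: measurableT_comp.
  apply/funext => z; rewrite mkseq_rcons ltnn; congr (H (rcons _ _)).
  by apply: eq_mkseq_lt => i ->.
(* The bound gains the length [2r] of the interval of integration. *)
exists (M * (r *+ 2)), r; split => //; first by rewrite mulr_ge0// mulrn_wge0.
move=> s sn; have mH1 : measurable_fun setT (fun x => H (rcons s x)).
  by apply: pmeas_fun1; rewrite sn.
case: ifPn => sr.
  apply: dom1_Rintegral => // x; apply: le_trans (HM _ _) _.
    by rewrite size_rcons sn.
  by rewrite all_rcons sr andbT.
(* Outside the box the integrand vanishes identically, so the same estimate is used with bound 0. *)
have <- : 0 * (r *+ 2) = 0 :> R by rewrite mul0r.
apply: dom1_Rintegral => // x; apply: le_trans (HM _ _) _.
  by rewrite size_rcons sn.
by rewrite all_rcons (negbTE sr) andbF; case: ifP.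
Qed.

(** Induction on [n] with a growing prefix: once the inner [n] variables are integrated, the
    remaining one is the last entry of the prefix and is integrated out in turn. *)
Lemma box_integrable_iterint k n F : box_integrable (k + n) F ->
  box_integrable k (fun s => iterint n (fun s' => F (s ++ s'))).
Proof.
elim: n k F => [|n IH] k F.
  by rewrite addn0; under eq_fun do rewrite /= cats0.
rewrite addnS -addSn => /IH/box_integrable_int_last.
by under eq_fun do under eq_fun do under eq_fun do rewrite cat_rcons.
Qed.

Lemma box_integrable1P F : box_integrable 1 F -> exists M r, [/\ 0 <= M, 0 <= r,
   measurable_fun setT (fun x => F [:: x]) & dom1 M r (fun x => F [:: x])].
Proof.
move=> [mF [M [r [M0 r0 FM]]]]; exists M, r; split => //.
  exact: (@pmeas_fun1 F [::]).
by move=> x; have /= := FM [:: x] erefl; rewrite andbT.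
Qed.

Lemma box_integrable_head n F : box_integrable n.+1 F -> exists M r, [/\ 0 <= M, 0 <= r,
   measurable_fun setT (fun x => iterint n (fun s => F (x :: s)))
  & dom1 M r (fun x => iterint n (fun s => F (x :: s)))].
Proof. by rewrite -add1n => /box_integrable_iterint/box_integrable1P. Qed.

Lemma box_integrable_head_integrable n F : box_integrable n.+1 F ->
  mu.-integrable setT (EFin \o (fun x => iterint n (fun s => F (x :: s)))).
Proof. by move=> /box_integrable_head[M [r [M0 r0 mF FM]]]; exact: dom1_integrable FM. Qed.

Lemma box_integrable_head2 n F : box_integrable n.+2 F ->
  box_integrable2 (fun x y => iterint n (fun s => F [:: x, y & s])).
Proof.
rewrite -add2n => /box_integrable_iterint[mF [M [r [M0 r0 FM]]]]; split.
  pose g (i : nat) (z : measurableTypeR R * measurableTypeR R) :=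
    if i is 0 then z.1 else z.2.
  by have := mF _ _ g; apply => -[|i]; [exact: measurable_fst|exact: measurable_snd].
by exists M, r; split => // x y; have /= := FM [:: x; y] erefl; rewrite andbT.
Qed.

Lemma eq_iterint n F H : (forall s, size s = n -> F s = H s) ->
  iterint n F = iterint n H.
Proof.
elim: n F H => [|n IH] F H FH /=; first exact: FH.
by apply: eq_Rintegral => x _; apply: IH => s sn; rewrite FH//= sn.
Qed.

Lemma iterintD n F H : box_integrable n F -> box_integrable n H ->
  iterint n (fun s => F s + H s) = iterint n F + iterint n H.
Proof.
elim: n F H => [//|n IH] F H nF nH /=.
rewrite -RintegralD//; try exact: box_integrable_head_integrable.
by apply: eq_Rintegral => x _; apply: IH; exact: box_integrable_cons.
Qed.

Lemma iterintZ n a F : box_integrable n F -> iterint n (fun s => a * F s) = a * iterint n F.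
Proof.
elim: n F => [//|n IH] F nF /=.
rewrite -RintegralZl//; try exact: box_integrable_head_integrable.
by apply: eq_Rintegral => x _; apply: IH; exact: box_integrable_cons.
Qed.

(** Comparison with a cube; it serves to show that the unit ball has positive volume. *)
Lemma iterint_ge_box n F c e : 0 <= c -> 0 <= e -> box_integrable n F -> (forall s, 0 <= F s) ->
  (forall s, size s = n -> all (fun x => `|x| <= e) s -> c <= F s) ->
  c * (e *+ 2) ^+ n <= iterint n F.
Proof.
move=> c0 e0; elim: n F => [|n IH] F nF F0 Fc /=; first by rewrite expr0 mulr1 Fc.
have iF0 m H : (forall s, 0 <= H s) -> 0 <= iterint m H.
  by elim: m H => [|m IHm] H H0 //=; apply: Rintegral_ge0 => x _; exact: IHm.
rewrite exprSr mulrA -Rintegral_itvN//.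
apply: le_Rintegral => //.
- have ce : 0 <= c * (e *+ 2) ^+ n by rewrite mulr_ge0// exprn_ge0// mulrn_wge0.
  apply: (@dom1_integrable _ (c * (e *+ 2) ^+ n) e).
    by under eq_fun do rewrite indic_itvN; exact: measurable_funM.
  by move=> x; case: ifP => _; rewrite ?normr0// ger0_norm.
- exact: box_integrable_head_integrable.
- move=> x _; case: ifPn => xe; last exact: iF0.
  apply: IH => //; first exact: box_integrable_cons.
  by move=> s sn se; apply: Fc; rewrite /= ?sn ?xe.
Qed.

(** The discarded hyperplane is a single point for the outermost integral. It contains the origin,
    the only point where the radial projection is degenerate. *)
Lemma iterint_ae n F H : box_integrable n.+1 F -> box_integrable n.+1 H ->
  (forall x s, size s = n -> x != 0 -> F (x :: s) = H (x :: s)) ->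
  iterint n.+1 F = iterint n.+1 H.
Proof.
move=> /box_integrable_head[? [? [_ _ mF _]]] /box_integrable_head[? [? [_ _ mH _]]] FH /=.
congr fine; apply: ae_eq_integral => //; try exact/measurable_EFinP.
exists [set (0 : R)]%classic; split => //; first exact: lebesgue_measure_set1.
move=> x /= h; apply: contrapT => x0; apply: h => _.
congr (_%:E); apply: eq_iterint => s sn; apply: FH => //.
by apply/eqP.
Qed.

(** Only planes of two consecutive coordinates are rotated: they correspond to adjacent integrals in
    [iterint], and they suffice to carry any vector onto the first axis. *)
Fixpoint rotk k (c e : R) (s : seq R) : seq R :=
  match k, s with
  | 0, x :: y :: s' => [:: c * x - e * y, e * x + c * y & s']
  | k'.+1, x :: s' => x :: rotk k' c e s'
  | _, _ => s
  end.

Lemma iterint_rotk n k c e F : c ^+ 2 + e ^+ 2 = 1 -> c != -1 -> (k.+1 < n)%N ->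
  box_integrable n F -> iterint n (F \o rotk k c e) = iterint n F.
Proof.
move=> ce c1; elim: k n F => [|k IH] [|n]// F.
  by case: n => // n _ /box_integrable_head2 /(Rint2_rot ce c1).
move=> kn nF /=; apply: eq_Rintegral => x _.
by rewrite -(IH _ _ _ (box_integrable_cons x nF)).
Qed.

End IteratedIntegrals.

(** * Means over the real sphere *)

Section RealSphere.
Context {R : realType}.
Implicit Types (F H h : seq R -> R) (u s : seq R).

Fixpoint dots u s : R :=
  match u, s with a :: u', b :: s' => a * b + dots u' s' | _, _ => 0 end.

Lemma dotsE u s : size u = size s -> dots u s = \sum_(i < size s) u`_i * s`_i.
Proof.
elim: u s => [|a u IH] [|b s]//=; first by rewrite big_ord0.
by move=> [us]; rewrite big_ord_recl/= IH.
Qed.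

Lemma dots_mkseqr u (f : nat -> R) n : size u = n ->
  dots u (mkseq f n) = \sum_(i < n) u`_i * f i.
Proof.
move=> un; rewrite dotsE size_mkseq//.
by apply: eq_bigr => i _; rewrite nth_mkseq.
Qed.

Lemma dotss_ge0 s : 0 <= dots s s.
Proof. by elim: s => //= a s IH; rewrite addr_ge0// -expr2 sqr_ge0. Qed.

Lemma sqr_le_dotss s i : s`_i ^+ 2 <= dots s s.
Proof.
elim: s i => [|a s IH] [|i] //=; rewrite ?expr0n//.
  by rewrite -expr2 lerDl dotss_ge0.
by rewrite (le_trans (IH i))// lerDr -expr2 sqr_ge0.
Qed.

(** The transpose of a rotation is the rotation by the opposite angle. *)
Lemma dots_rotkr k c e u s : size u = size s ->
  dots u (rotk k c e s) = dots (rotk k c (- e) u) s.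
Proof.
elim: k u s => [|k IH] [|a [|b u]] [|x [|y s]]//=; first by move=> _; ring.
  by case: k {IH}.
by move=> [us]; rewrite -IH//= us.
Qed.

Lemma dotss_rotk k c e s : c ^+ 2 + e ^+ 2 = 1 ->
  dots (rotk k c e s) (rotk k c e s) = dots s s.
Proof.
move=> ce; elim: k s => [|k IH] [|x [|y s]]//=.
  transitivity ((c ^+ 2 + e ^+ 2) * (x * x + y * y) + dots s s); first by ring.
  by rewrite ce mul1r addrA.
  by case: k {IH}.
by congr (_ + _); exact: (IH (y :: s)).
Qed.

(** * Averages over the ball and their linearity *)

Definition unit_ball s : R := if dots s s <= 1 then 1 else 0.

Definition bdd_meas n h := pmeas n h /\ exists M, forall s, size s = n -> `|h s| <= M.

Lemma pmeas_nth n i : pmeas n (fun s : seq R => s`_i).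
Proof.
move=> disp T g mg; case: (ltnP i n) => ilt.
  by under eq_fun do rewrite nth_mkseq//; exact: mg.
by under eq_fun do rewrite nth_default ?size_mkseq//; exact: measurable_cst.
Qed.

Lemma pmeas_dotss n : pmeas n (fun s : seq R => dots s s).
Proof.
move=> disp T g mg; under eq_fun do rewrite dots_mkseqr ?size_mkseq//.
apply: measurable_sum => i; apply: measurable_funM => //.
by under eq_fun do rewrite nth_mkseq//; exact: mg.
Qed.

Lemma bdd_meas_cst n a : bdd_meas n (fun=> a).
Proof. by split; [move=> disp T g mg|exists `|a|]. Qed.

Lemma bdd_measD n h H : bdd_meas n h -> bdd_meas n H -> bdd_meas n (fun s => h s + H s).
Proof.
move=> [mh [M hM]] [mH [N HN]]; split.
  by move=> disp T g mg; apply: measurable_funD; [exact: mh|exact: mH].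
exists (M + N) => s sn; apply: le_trans (ler_normD _ _) _.
by rewrite lerD ?hM ?HN.
Qed.

Lemma bdd_measM n h H : bdd_meas n h -> bdd_meas n H -> bdd_meas n (fun s => h s * H s).
Proof.
move=> [mh [M hM]] [mH [N HN]]; split.
  by move=> disp T g mg; apply: measurable_funM; [exact: mh|exact: mH].
by exists (M * N) => s sn; rewrite normrM ler_pM ?hM ?HN.
Qed.

Lemma bdd_measX n h m : bdd_meas n h -> bdd_meas n (fun s => h s ^+ m).
Proof.
move=> ah; elim: m => [|m IH]; first exact: bdd_meas_cst.
by under eq_fun do rewrite exprS; exact: bdd_measM.
Qed.

Lemma bdd_meas_sum n (I : Type) (r : seq I) (P : pred I) (f : I -> seq R -> R) :
  (forall i, P i -> bdd_meas n (f i)) -> bdd_meas n (fun s => \sum_(i <- r | P i) f i s).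
Proof.
move=> af; elim: r => [|i r IH].
  by under eq_fun do rewrite big_nil; exact: bdd_meas_cst.
under eq_fun do rewrite big_cons; case: (boolP (P i)) => // Pi.
by apply: bdd_measD => //; exact: af.
Qed.

(** Coordinate of the radial projection of [s] to the sphere; at the origin division by zero gives
    the value 0. *)
Definition ycoord s i := s`_i / Num.sqrt (dots s s).

Lemma bdd_meas_ycoord n i : bdd_meas n (ycoord^~ i).
Proof.
split.
  move=> disp T g mg; apply: measurable_funM; first exact: pmeas_nth.
  (* The inverse norm is rewritten as the power -1/2 of the squared norm, a measurable function. *)
  rewrite (_ : (fun _ => _) = (fun x => x `^ (- 2^-1)) \o
    (fun t => dots (mkseq (g^~ t) n) (mkseq (g^~ t) n))); last first.
    by apply/funext => t /=; rewrite powRN powR12_sqrt// dotss_ge0.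
  apply: measurableT_comp; first exact: measurable_powR.
  exact: pmeas_dotss.
exists 1 => s _; rewrite /ycoord normrM normfV [X in _ / X]ger0_norm ?sqrtr_ge0//.
have [->|N0] := eqVneq (dots s s) 0; first by rewrite sqrtr0 invr0 mulr0.
have Np : 0 < dots s s by rewrite lt_neqAle eq_sym N0 dotss_ge0.
rewrite ler_pdivrMr ?sqrtr_gt0// mul1r -sqrtr_sqr ler_wsqrtr//.
exact: sqr_le_dotss.
Qed.

Lemma box_integrable_ball n h : bdd_meas n h -> box_integrable n (fun s => unit_ball s * h s).
Proof.
move=> [mh [M hM]]; split.
  move=> disp T g mg; apply: measurable_funM; last exact: mh.
  apply: measurable_fun_ifT => //.
  by apply: measurable_fun_ler => //; exact: pmeas_dotss.
exists `|M|, 1; split => // s sn.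
rewrite normrM /unit_ball; case: ifPn => [s1|_]; last first.
  by rewrite normr0 mul0r; case: ifP.
rewrite normr1 mul1r ifT; first by apply: le_trans (hM _ sn) (ler_norm _).
apply/(all_nthP 0) => i _.
rewrite -sqrtr_sqr -(sqrtr1) ler_wsqrtr//.
exact: le_trans (sqr_le_dotss _ _) s1.
Qed.

(** When [h] depends only on the direction of [s], this average over the solid ball is the
    normalised integral over the unit sphere. *)
Definition mean n h := iterint n (fun s => unit_ball s * h s) / iterint n unit_ball.

Lemma vol_gt0 n : 0 < iterint n unit_ball.
Proof.
(* The cube of half-side [e] lies in the ball, since [n e^2 <= n e <= 1]; the successor keeps [e]
   meaningful for [n = 0]. *)
pose e : R := n.+1%:R^-1.
have e0 : 0 < e by rewrite invr_gt0.
have e1 : e <= 1 by rewrite invf_le1// ler1n.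
apply: (@lt_le_trans _ _ (1 * (e *+ 2) ^+ n)).
  by rewrite mul1r exprn_gt0// pmulrn_lgt0.
apply: iterint_ge_box => //; first exact: ltW.
- by have := box_integrable_ball (bdd_meas_cst n 1); under eq_fun do rewrite mulr1.
- by move=> s; rewrite /unit_ball; case: ifP.
move=> s sn se; rewrite /unit_ball ifT// dotsE// sn.
apply: (@le_trans _ _ (\sum_(i < n) e)).
  apply: ler_sum => i _; rewrite -expr2 -[_ ^+ 2]ger0_norm ?sqr_ge0// normrX.
  have ie : `|s`_i| <= e by move/(all_nthP 0): se; apply; rewrite sn.
  rewrite (le_trans (lerXn2r 2 _ _ ie)) ?nnegrE//; first exact: ltW.
  by rewrite expr2 ler_piMl// ltW.
by rewrite sumr_const card_ord -mulr_natl ler_pdivrMr// mul1r ler_nat.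
Qed.

Lemma vol_neq0 n : iterint n unit_ball != 0.
Proof. by rewrite gt_eqF// vol_gt0. Qed.

Lemma eq_mean n h H : (forall s, size s = n -> h s = H s) -> mean n h = mean n H.
Proof. by move=> hH; congr (_ / _); apply: eq_iterint => s sn; rewrite hH. Qed.

Lemma mean_ae n h H : bdd_meas n.+1 h -> bdd_meas n.+1 H ->
  (forall s, size s = n.+1 -> dots s s != 0 -> h s = H s) ->
  mean n.+1 h = mean n.+1 H.
Proof.
move=> ah aH hH; congr (_ / _); apply: iterint_ae; try exact: box_integrable_ball.
move=> x s sn x0; rewrite hH//= ?sn//.
by rewrite gt_eqF// ltr_pwDl ?dotss_ge0// -expr2 exprn_even_gt0.
Qed.

Lemma meanD n h H : bdd_meas n h -> bdd_meas n H ->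
  mean n (fun s => h s + H s) = mean n h + mean n H.
Proof.
move=> ah aH; rewrite /mean -mulrDl -iterintD; try exact: box_integrable_ball.
by under eq_iterint do rewrite mulrDr.
Qed.

Lemma meanZ n a h : bdd_meas n h -> mean n (fun s => a * h s) = a * mean n h.
Proof.
move=> ah; rewrite /mean mulrA -iterintZ; last exact: box_integrable_ball.
by under eq_iterint do rewrite mulrCA.
Qed.

Lemma mean_cst n a : mean n (fun=> a) = a.
Proof.
rewrite -(@eq_mean n (fun=> a * 1)) ?meanZ => [||s _]; rewrite ?mulr1//; last exact: bdd_meas_cst.
by rewrite /mean; under eq_iterint do rewrite mulr1; rewrite divff ?mulr1// vol_neq0.
Qed.

Lemma mean_sum n (I : Type) (r : seq I) (P : pred I) (f : I -> seq R -> R) :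
  (forall i, P i -> bdd_meas n (f i)) ->
  mean n (fun s => \sum_(i <- r | P i) f i s) = \sum_(i <- r | P i) mean n (f i).
Proof.
move=> af; elim: r => [|i r IH].
  by rewrite big_nil; under eq_mean do rewrite big_nil; rewrite mean_cst.
rewrite big_cons -IH; under eq_mean do rewrite big_cons.
case: (boolP (P i)) => // Pi; rewrite meanD//; first exact: af.
exact: bdd_meas_sum.
Qed.

Lemma mean_rotk n k c e h : c ^+ 2 + e ^+ 2 = 1 -> c != -1 -> (k.+1 < n)%N ->
  bdd_meas n h -> mean n (h \o rotk k c e) = mean n h.
Proof.
move=> ce c1 kn /box_integrable_ball nh; congr (_ / _).
rewrite -[RHS](iterint_rotk ce c1 kn nh).
by apply: eq_iterint => s _; rewrite /= /unit_ball dotss_rotk.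
Qed.

End RealSphere.

(** * Moments of linear forms *)

(** A nonzero difference would have more roots than its degree. This permits comparing coefficients
    after evaluation at the natural numbers, and later at points of the unit circle. *)
Lemma poly_eq_on_seq (K : idomainType) (p q : {poly K}) (x : nat -> K) :
  injective x -> (forall i, p.[x i] = q.[x i]) -> p = q.
Proof.
move=> xI pq; apply/eqP; rewrite -subr_eq0; apply/eqP.
apply: (@roots_geq_poly_eq0 _ _ (mkseq x (size (p - q)))).
- by apply/allP => _ /mapP[i _ ->]; rewrite /root hornerD hornerN pq subrr.
- by rewrite map_inj_uniq ?iota_uniq.
- by rewrite size_mkseq.
Qed.

Section RealMoments.
Context {R : realType}.
Implicit Types (u s : seq R).

(** By induction the tail of [u] is first turned onto its own axis; one more rotation, in the first
    two coordinates, absorbs what is left into the first. The sign of [x] stays unspecified. *)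
Lemma rot_canonical (phi : seq R -> R) n u : size u = n.+1 ->
  (forall k c e v, size v = n.+1 -> (k < n)%N -> c ^+ 2 + e ^+ 2 = 1 -> c != -1 ->
    phi (rotk k c e v) = phi v) ->
  exists2 x, x ^+ 2 = dots u u & phi u = phi (x :: nseq n 0).
Proof.
elim: n phi u => [|n IH] phi [|a u]//= [us] rphi.
  by exists a; case: u us => //= _; rewrite addr0 expr2.
have [|x xu ->] := IH (fun v => phi (a :: v)) u us.
  by move=> k c e v vs kn ce c1; rewrite -(rphi k.+1 c e (a :: v))//= vs.
have [x0|x0] := eqVneq x 0.
  by exists a; rewrite -?xu x0 ?expr0n ?addr0 ?expr2.
have N0 : 0 < a ^+ 2 + x ^+ 2 by rewrite ltr_wpDl ?sqr_ge0// exprn_even_gt0.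
set r := Num.sqrt (a ^+ 2 + x ^+ 2).
have r2 : r ^+ 2 = a ^+ 2 + x ^+ 2 by rewrite sqr_sqrtr// ltW.
have r0 : r != 0 by rewrite gt_eqF// sqrtr_gt0.
exists r; first by rewrite r2 -xu expr2.
rewrite -(rphi 0%N (a / r) (- x / r)) ?size_nseq//=.
- congr phi; congr (_ :: _).
    by apply: (mulfI r0); rewrite -expr2 r2; field.
  by congr (_ :: _); field.
- by rewrite size_nseq.
- by rewrite !expr_div_n sqrrN -mulrDl -r2 divff// expf_neq0.
(* A half-turn would mean [a = -r], forcing [x = 0], a case already settled. *)
- apply/eqP => ar; have {}ar : a = - r by rewrite -[a](divfK r0) ar mulN1r.
  by move: r2; rewrite ar sqrrN => /eqP; rewrite addrC -subr_eq subrr eq_sym sqrf_eq0 (negbTE x0).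
Qed.

Definition ydot u s := dots u s / Num.sqrt (dots s s).

Lemma ydotE u s : size u = size s -> ydot u s = \sum_(i < size s) u`_i * ycoord s i.
Proof.
by move=> us; rewrite /ydot dotsE// mulr_suml; apply: eq_bigr => i _; rewrite -mulrA.
Qed.

Lemma bdd_meas_ydot n u : size u = n -> bdd_meas n (ydot u).
Proof.
move=> un; split.
  move=> disp T g mg.
  have [mh _] : bdd_meas n (fun s => \sum_(i < n) u`_i * ycoord s i).
    by apply: bdd_meas_sum => i _; apply: bdd_measM; [exact: bdd_meas_cst|exact: bdd_meas_ycoord].
  have := mh _ _ g mg; congr (measurable_fun _ _); apply/funext => t.
  by rewrite ydotE ?size_mkseq.
have [_ [M hM]] : bdd_meas n (fun s => \sum_(i < n) u`_i * ycoord s i).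
  by apply: bdd_meas_sum => i _; apply: bdd_measM; [exact: bdd_meas_cst|exact: bdd_meas_ycoord].
by exists M => s sn; rewrite ydotE ?un// sn hM.
Qed.

Definition moment n m u := mean n (fun s => ydot u s ^+ m).

Lemma moment_rotk n m k c e u : size u = n -> (k.+1 < n)%N ->
  c ^+ 2 + e ^+ 2 = 1 -> c != -1 -> moment n m (rotk k c e u) = moment n m u.
Proof.
move=> un kn ce c1; have ce' : c ^+ 2 + (- e) ^+ 2 = 1 by rewrite sqrrN.
rewrite /moment -[RHS](mean_rotk ce' c1 kn); last exact/bdd_measX/bdd_meas_ydot.
apply: eq_mean => s sn /=.
by rewrite /ydot dotss_rotk// dots_rotkr ?opprK// un sn.
Qed.

Lemma momentZ n m a u : size u = n -> moment n m (map ( *%R a) u) = a ^+ m * moment n m u.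
Proof.
move=> un; rewrite -meanZ; last exact/bdd_measX/bdd_meas_ydot.
apply: eq_mean => s sn; rewrite -exprMn; congr (_ ^+ _).
rewrite /ydot mulrA; congr (_ / _).
elim: u s {un sn} => [|b u IH] [|x s] /=; rewrite ?mulr0//.
by rewrite IH mulrDr mulrA.
Qed.

(** The constant [c_m]: by rotation invariance and homogeneity, the value on the first axis
    determines every moment. *)
Definition moment1 n m := moment n m (1 :: nseq n.-1 0).

Lemma moment_axis n m x :
  moment n.+1 m (x :: nseq n 0) = x ^+ m * moment1 n.+1 m.
Proof.
rewrite /moment1 -momentZ ?size_nseq//= ?size_nseq//.
by rewrite map_nseq mulr1 mulr0.
Qed.

Lemma moment_even n k u : size u = n.+1 ->
  moment n.+1 k.*2 u = dots u u ^+ k * moment1 n.+1 k.*2.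
Proof.
move=> un; have [|x xu ->] := @rot_canonical (moment n.+1 k.*2) n u un.
  by move=> j c e v vn jn ce c1; exact: moment_rotk.
by rewrite moment_axis -muln2 mulnC exprM xu.
Qed.

(** Quarter turns carry both [e_0] and [-e_0] to [e_1], so their moments agree, while homogeneity
    makes them opposite for odd [m]. The two explicit coordinates provide the plane for these
    turns. *)
Lemma moment_odd n m u : odd m -> size u = n.+2 -> moment n.+2 m u = 0.
Proof.
move=> om un; have [|x xu ->] := @rot_canonical (moment n.+2 m) n.+1 u un.
  by move=> j c e v vn jn ce c1; exact: moment_rotk.
rewrite moment_axis; suff -> : moment1 n.+2 m = 0 by rewrite mulr0.
have r1 : (0 : R) != -1 by rewrite eq_sym oppr_eq0 oner_eq0.
have quarter e : e ^+ 2 = 1 ->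
    moment n.+2 m [:: e, 0 & nseq n 0] = moment n.+2 m [:: 0, 1 & nseq n 0].
  move=> ee; have := @moment_rotk n.+2 m 0 0 e [:: e, 0 & nseq n 0].
  rewrite /= size_nseq !mul0r mulr0 subr0 addr0 -expr2 ee => <- //.
  by rewrite expr0n add0r.
have e1 := quarter 1 (expr1n _ _).
have e2 : moment n.+2 m [:: -1, 0 & nseq n 0] = _ := quarter (-1) (sqrr_sign _ 1).
have := moment_axis n.+1 m (-1).
rewrite e2 -e1 -signr_odd om expr1 mulN1r -/(moment1 _ _) => /eqP.
by rewrite -subr_eq0 opprK -mulr2n mulrn_eq0 => /eqP.
Qed.

Lemma sum_delta n j (h : nat -> R) : (j < n)%N ->
  \sum_(i < n) (i == j :> nat)%:R * h i = h j.
Proof.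
move=> jn; rewrite (bigD1 (Ordinal jn))//= eqxx mul1r big1 ?addr0// => i ij.
by rewrite (_ : (i == j :> nat) = false) ?mul0r//; exact/negbTE.
Qed.

Lemma coef2_expr1DX2 m : ((1 + 'X^2 : {poly R}) ^+ m)`_2 = m%:R.
Proof.
suff [] : ((1 + 'X^2 : {poly R}) ^+ m)`_0 = 1 /\ ((1 + 'X^2 : {poly R}) ^+ m)`_2 = m%:R by [].
elim: m => [|m [IH0 IH2]]; first by rewrite expr0 !coef1.
by rewrite exprS mulrDl mul1r !coefD !coefXnM/= IH0 IH2 addr0 -natr1.
Qed.

(* Compares the coefficients of [t ^+ 2] in the moments of [e_0 + t e_j]. *)
Lemma mean_ycoord_sqr n k j : (0 < j < n.+1)%N ->
  mean n.+1 (fun s => ycoord s 0 ^+ k.*2 * ycoord s j ^+ 2) *+ k.*2.+1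
  = moment1 n.+1 k.+1.*2.
Proof.
move=> /andP[j0 jn].
set c := moment1 _ _; set K := k.+1.*2 in c *.
pose a i := mean n.+1 (fun s => ycoord s 0 ^+ (K - i) * ycoord s j ^+ i).
have aA i : bdd_meas n.+1 (fun s => ycoord s 0 ^+ (K - i) * ycoord s j ^+ i).
  by apply: bdd_measM; apply/bdd_measX/bdd_meas_ycoord.
pose p : {poly R} := \poly_(i < K.+1) (a i *+ 'C(K, i)).
pose q : {poly R} := c *: (1 + 'X^2) ^+ k.+1.
(* Both polynomials evaluate at [t] to the moment of [e_0 + t e_j]: [p] by the binomial expansion,
   [q] because the squared norm of that vector is [1 + t^2]. *)
have pq : p = q.
  apply: (@poly_eq_on_seq _ _ _ (fun i => i%:R)) => [i i' /eqP|t].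
    by rewrite eqr_nat => /eqP.
  pose u := mkseq (fun i => (i == 0%N)%:R + t%:R * (i == j)%:R : R) n.+1.
  have us : size u = n.+1 by rewrite size_mkseq.
  have uE (h : nat -> R) : \sum_(i < n.+1) u`_i * h i = h 0%N + t%:R * h j.
    rewrite -(sum_delta h (ltn0Sn n)) -(sum_delta h jn) mulr_sumr -big_split/=.
    by apply: eq_bigr => i _; rewrite nth_mkseq// mulrDl mulrA.
  transitivity (moment n.+1 K u).
    rewrite /moment (@eq_mean _ _ _ (fun s => \sum_(i < K.+1)
        (t%:R ^+ i *+ 'C(K, i)) * (ycoord s 0 ^+ (K - i) * ycoord s j ^+ i))).
      rewrite mean_sum => [|i _]; last by apply: bdd_measM => //; exact: bdd_meas_cst.
      rewrite horner_poly; apply: eq_bigr => i _.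
      by rewrite meanZ// -/(a i) !mulrnAl mulrC.
    move=> s sn; rewrite ydotE ?us ?sn// uE exprDn; apply: eq_bigr => i _.
    by rewrite [(_ * ycoord s j) ^+ i]exprMn mulrnAl mulrCA.
  rewrite moment_even// -/c /q hornerZ horner_exp hornerD hornerC hornerXn mulrC; congr (_ * _ ^+ _).
  rewrite dotsE// us uE !nth_mkseq// eqxx (gtn_eqF j0) (ltn_eqF j0) eqxx.
  by rewrite mulr0 addr0 add0r mulr1 expr2.
have := congr1 (fun r : {poly R} => r`_2) pq.
rewrite /p /q coefZ coef2_expr1DX2 coef_poly.
have -> : (2 < K.+1)%N by rewrite /K doubleS.
(* The factor [k + 1] cancels against the coefficient of [t^2] in [(1 + t^2)^(k+1)]. *)
have -> : 'C(K, 2) = (k.*2.+1 * k.+1)%N.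
  by rewrite bin2 /K -doubleMl doubleK mulnC doubleS.
have -> : a 2%N = mean n.+1 (fun s => ycoord s 0 ^+ k.*2 * ycoord s j ^+ 2).
  by rewrite /a /K doubleS subn2.
rewrite mulrnA mulr_natr => /eqP; rewrite eqr_pMn2r// => /eqP ->.
by [].
Qed.

(** Insert [1 = sum_i y_i^2] into the mean of [y_0^(2k)]. After multiplication by [2k+1], the term
    [i = 0] contributes [(2k+1) c] and each of the [n] others contributes [c]. *)
Lemma moment1_rec n k :
  moment1 n.+1 k.+1.*2 * (n.+1 + k.*2)%:R = k.*2.+1%:R * moment1 n.+1 k.*2.
Proof.
set c := moment1 n.+1 k.+1.*2.
have e0 s : size s = n.+1 -> ydot (1 :: nseq n 0) s = ycoord s 0.
  case: s => //= x s [sn]; rewrite /ydot /ycoord/= mul1r; congr (_ / _).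
  rewrite -[RHS]addr0; congr (_ + _).
  by elim: s n sn {c} => [|y s IH] [|n]//= [sn]; rewrite mul0r add0r IH.
have a0 i m j : bdd_meas n.+1 (fun s => ycoord s 0 ^+ m * ycoord s i ^+ j : R).
  by apply: bdd_measM; apply/bdd_measX/bdd_meas_ycoord.
have -> : moment1 n.+1 k.*2 = \sum_(i < n.+1)
    mean n.+1 (fun s => ycoord s 0 ^+ k.*2 * ycoord s i ^+ 2).
  (* The squares sum to 1 only away from the origin, hence an almost-everywhere comparison. *)
  rewrite -mean_sum//; apply: mean_ae => //.
  - by apply/bdd_measX/bdd_meas_ydot; rewrite /= size_nseq.
  - exact: bdd_meas_sum.
  - move=> s sn N0; rewrite e0// -mulr_sumr.
    rewrite (_ : \sum_i _ = 1) ?mulr1// -(divff N0) [in RHS]dotsE// mulr_suml sn.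
    apply: eq_bigr => i _; rewrite /ycoord exprMn exprVn sqr_sqrtr ?dotss_ge0//.
    by rewrite expr2 dotsE// sn.
have c0 : mean n.+1 (fun s => ycoord s 0 ^+ k.*2 * ycoord s 0 ^+ 2) = c.
  apply: eq_mean => s sn; rewrite e0//.
  by rewrite -exprD addn2 doubleS.
rewrite big_ord_recl/= c0 mulrDr mulr_sumr (eq_bigr (fun=> c)); last first.
  by move=> i _; rewrite mulr_natl mean_ycoord_sqr// (ltn_ord (lift ord0 i)).
rewrite sumr_const card_ord -[c *+ n]mulr_natr [_ * c]mulrC -mulrDr; congr (_ * _).
by rewrite -natrD; congr _%:R; lia.
Qed.

Lemma moment1E n k : moment1 n.+1 k.*2 *
  (\prod_(i < k) (n.+1 + i.*2))%N%:R = (\prod_(i < k) i.*2.+1)%N%:R.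
Proof.
elim: k => [|k IH].
  rewrite !big_ord0 mulr1; apply: etrans (mean_cst n.+1 1).
  exact: eq_mean.
by rewrite !big_ord_recr/= !natrM -IH mulrCA moment1_rec; ring.
Qed.

End RealMoments.

(** * The complex sphere *)

Section ComplexSphere.
Context {R : realType}.
Notation C := R[i].
Implicit Types (s : seq R).

Fixpoint cpair s : seq C :=
  if s is x :: y :: s' then x +i* y :: cpair s' else [::].

Lemma iter_cintE d (g : seq C -> R) :
  iter_cint d g = iterint d.*2 (fun s => g (cpair s)).
Proof.
elim: d g => [//|d IH] g /=.
by apply: eq_Rintegral => x _; apply: eq_Rintegral => y _; rewrite IH.
Qed.

Lemma nth_cpair s i d : size s = d.*2 -> nth 0 (cpair s) i = s`_i.*2 +i* s`_i.*2.+1.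
Proof.
elim: d s i => [|d IH] [|x [|y s]] [|i]//= [sd]; exact: IH.
Qed.

Lemma sum_double (V : nmodType) n (f : nat -> V) :
  \sum_(i < n.*2) f i = \sum_(i < n) (f i.*2 + f i.*2.+1).
Proof.
elim: n => [|n IH]; first by rewrite !big_ord0.
by rewrite doubleS !big_ord_recr/= IH addrA.
Qed.

(** The direction of [s] in [R^{2d}], read as a point of the sphere of [C^d]. *)
Definition yvec d s : 'rV[C]_d := \row_i (ycoord s i.*2 +i* ycoord s i.*2.+1).

Lemma cinnerE d (z w : 'rV[C]_d) : cinner z w =
  (\sum_i (complex.Re (z 0 i) * complex.Re (w 0 i) + complex.Im (z 0 i) * complex.Im (w 0 i)))
  +i* (\sum_i (complex.Im (z 0 i) * complex.Re (w 0 i) - complex.Re (z 0 i) * complex.Im (w 0 i))).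
Proof.
rewrite /cinner; elim/big_rec3: _ => [//|i x y t _ ->].
by case: (z 0 i) (w 0 i) => [a b] [c e] /=; apply/eqP; rewrite eq_complex/=; apply/andP; split; apply/eqP; ring.
Qed.

Lemma cnorm2_vec d s : size s = d.*2 -> cnorm2 (vec_of_seq d (cpair s)) = dots s s.
Proof.
move=> sd; rewrite /cnorm2 cinnerE/= dotsE// sd (sum_double _ (fun i => s`_i * s`_i)).
by apply: eq_bigr => i _; rewrite !mxE (nth_cpair _ sd).
Qed.

Lemma normalize_vec d s : size s = d.*2 ->
  normalize (vec_of_seq d (cpair s)) = yvec d s.
Proof.
move=> sd; apply/rowP => i; rewrite !mxE cnorm2_vec// (nth_cpair _ sd).
apply/eqP; rewrite eq_complex/= !mul0r subr0 addr0 /ycoord.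
by rewrite ![_ / Num.sqrt _]mulrC !eqxx.
Qed.

Lemma sphere_int_realE d (h : 'rV[C]_d -> R) :
  sphere_int_real h = mean d.*2 (fun s => h (yvec d s)).
Proof.
rewrite /sphere_int_real /mean !iter_cintE; congr (_ / _).
  by apply: eq_iterint => s sd; rewrite normalize_vec// /ball_ind cnorm2_vec.
by apply: eq_iterint => s sd; rewrite /ball_ind cnorm2_vec.
Qed.

(** * Linearity of the sphere integral for complex-valued functions *)

Definition cbdd_meas d (f : 'rV[C]_d -> C) :=
  bdd_meas d.*2 (fun s => complex.Re (f (yvec d s))) /\
  bdd_meas d.*2 (fun s => complex.Im (f (yvec d s))).

Lemma cbdd_meas_cst d a : cbdd_meas (fun _ : 'rV[C]_d => a).
Proof. by split; exact: bdd_meas_cst. Qed.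

Lemma cbdd_measD d (f g : 'rV[C]_d -> C) : cbdd_meas f -> cbdd_meas g -> cbdd_meas (fun z => f z + g z).
Proof.
move=> [fr fi] [gr gi]; split.
  by under eq_fun do rewrite raddfD; exact: bdd_measD.
by under eq_fun do rewrite raddfD; exact: bdd_measD.
Qed.

(** The difference is written with a factor [-1] so that closure under sums, products and constants
    applies directly. *)
Lemma ReM (x y : C) : complex.Re (x * y) =
  complex.Re x * complex.Re y + -1 * (complex.Im x * complex.Im y).
Proof. by case: x y => [a b] [c e] /=; ring. Qed.

Lemma ImM (x y : C) : complex.Im (x * y) =
  complex.Re x * complex.Im y + complex.Im x * complex.Re y.
Proof. by case: x y => [a b] [c e] /=; ring. Qed.

Lemma cbdd_measM d (f g : 'rV[C]_d -> C) : cbdd_meas f -> cbdd_meas g -> cbdd_meas (fun z => f z * g z).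
Proof.
move=> [fr fi] [gr gi]; split.
  under eq_fun do rewrite ReM.
  by apply: bdd_measD; [|apply: bdd_measM; first exact: bdd_meas_cst]; exact: bdd_measM.
by under eq_fun do rewrite ImM; apply: bdd_measD; exact: bdd_measM.
Qed.

Lemma ReJ (x : C) : complex.Re x^* = complex.Re x. Proof. by case: x. Qed.
Lemma ImJ (x : C) : complex.Im x^* = -1 * complex.Im x.
Proof. by case: x => a b /=; rewrite mulN1r. Qed.

Lemma cbdd_measJ d (f : 'rV[C]_d -> C) : cbdd_meas f -> cbdd_meas (fun z => (f z)^*).
Proof.
move=> [fr fi]; split; first by under eq_fun do rewrite ReJ.
by under eq_fun do rewrite ImJ; apply: bdd_measM => //; exact: bdd_meas_cst.
Qed.

Lemma cbdd_meas_coord d i : cbdd_meas (fun z : 'rV[C]_d => z 0 i).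
Proof. by split; under eq_fun do rewrite mxE; exact: bdd_meas_ycoord. Qed.

Lemma cbdd_meas_prod d (I : Type) (r : seq I) (P : pred I) (f : I -> 'rV[C]_d -> C) :
  (forall i, P i -> cbdd_meas (f i)) -> cbdd_meas (fun z => \prod_(i <- r | P i) f i z).
Proof.
move=> af; elim: r => [|i r IH].
  by under [fun z => _]eq_fun do rewrite big_nil; exact: cbdd_meas_cst.
under [fun z => _]eq_fun do rewrite big_cons; case: (boolP (P i)) => // Pi.
by apply: cbdd_measM => //; exact: af.
Qed.

Lemma cbdd_meas_sum d (I : Type) (r : seq I) (P : pred I) (f : I -> 'rV[C]_d -> C) :
  (forall i, P i -> cbdd_meas (f i)) -> cbdd_meas (fun z => \sum_(i <- r | P i) f i z).
Proof.
move=> af; elim: r => [|i r IH].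
  by under [fun z => _]eq_fun do rewrite big_nil; exact: cbdd_meas_cst.
under [fun z => _]eq_fun do rewrite big_cons; case: (boolP (P i)) => // Pi.
by apply: cbdd_measD => //; exact: af.
Qed.

Lemma cbdd_measX d (f : 'rV[C]_d -> C) n : cbdd_meas f -> cbdd_meas (fun z => f z ^+ n).
Proof.
move=> af; elim: n => [|n IH]; first exact: cbdd_meas_cst.
by under [fun z => _]eq_fun do rewrite exprS; exact: cbdd_measM.
Qed.

Lemma sphere_intE d (f : 'rV[C]_d -> C) : sphere_int f =
  mean d.*2 (fun s => complex.Re (f (yvec d s))) +i*
  mean d.*2 (fun s => complex.Im (f (yvec d s))).
Proof. by rewrite /sphere_int !sphere_int_realE. Qed.

Lemma eq_sphere_int d (f g : 'rV[C]_d -> C) : f =1 g -> sphere_int f = sphere_int g.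
Proof. by move=> /funext ->. Qed.

Lemma sphere_intD d (f g : 'rV[C]_d -> C) : cbdd_meas f -> cbdd_meas g ->
  sphere_int (fun z => f z + g z) = sphere_int f + sphere_int g.
Proof.
move=> [fr fi] [gr gi]; rewrite !sphere_intE; apply/eqP; rewrite eq_complex/=.
by apply/andP; split; apply/eqP; rewrite -meanD//; apply: eq_mean => s _; rewrite raddfD.
Qed.

Lemma sphere_intZ d a (f : 'rV[C]_d -> C) : cbdd_meas f ->
  sphere_int (fun z => a * f z) = a * sphere_int f.
Proof.
case: a => [b c] [fr fi]; rewrite !sphere_intE; apply/eqP; rewrite eq_complex/=.
apply/andP; split; apply/eqP.
  rewrite -mulNr -!meanZ// -meanD; try by apply: bdd_measM => //; exact: bdd_meas_cst.
  by apply: eq_mean => s _; rewrite ReM/=; ring.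
rewrite -!meanZ// -meanD; try by apply: bdd_measM => //; exact: bdd_meas_cst.
by apply: eq_mean => s _; rewrite ImM/=; ring.
Qed.

Lemma sphere_int_cst d a : sphere_int (fun _ : 'rV[C]_d => a) = a.
Proof. by rewrite sphere_intE !mean_cst; case: a. Qed.

Lemma sphere_int_sum d (I : Type) (r : seq I) (P : pred I) (f : I -> 'rV[C]_d -> C) :
  (forall i, P i -> cbdd_meas (f i)) ->
  sphere_int (fun z => \sum_(i <- r | P i) f i z) = \sum_(i <- r | P i) sphere_int (f i).
Proof.
move=> af; elim: r => [|i r IH].
  by rewrite big_nil; under eq_sphere_int do rewrite big_nil; rewrite sphere_int_cst.
rewrite big_cons -IH; under eq_sphere_int do rewrite big_cons.
case: (boolP (P i)) => // Pi; rewrite sphere_intD//; first exact: af.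
exact: cbdd_meas_sum.
Qed.

(** [yvec] is a unit vector except over the origin, which is negligible. *)
Lemma sphere_int_unit d (f g : 'rV[C]_d.+1 -> C) : cbdd_meas f -> cbdd_meas g ->
  (forall z, cinner z z = 1 -> f z = g z) -> sphere_int f = sphere_int g.
Proof.
move=> [fr fi] [gr gi] fg.
have E s : size s = d.+1.*2 -> dots s s != 0 -> f (yvec d.+1 s) = g (yvec d.+1 s).
  move=> sd N0; apply: fg; rewrite cinnerE; apply/eqP; rewrite eq_complex/=.
  apply/andP; split; apply/eqP; last by rewrite big1// => i _; rewrite mulrC subrr.
  transitivity (\sum_(i < d.+1.*2) s`_i * s`_i / dots s s); last first.
    by rewrite -mulr_suml -sd -dotsE// divff.
  rewrite (sum_double _ (fun i => s`_i * s`_i / dots s s)).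
  have yy i : ycoord s i * ycoord s i = s`_i * s`_i / dots s s.
    by rewrite -expr2 /ycoord exprMn exprVn sqr_sqrtr ?dotss_ge0// expr2.
  by apply: eq_bigr => i _; rewrite !mxE/= !yy.
rewrite !sphere_intE; congr (_ +i* _); apply: mean_ae => // s sd N0; rewrite E//.
Qed.


(** * Complex vectors as real ones, and the constants [b_m] *)

Definition wnth d (w : 'rV[C]_d) k : C := nth 0 (codom (w 0)) k.

Lemma wnthE d (w : 'rV[C]_d) (i : 'I_d) : wnth w i = w 0 i.
Proof.
by rewrite /wnth (nth_map i) ?size_enum_ord// nth_ord_enum.
Qed.

Definition realif d (w : 'rV[C]_d) : seq R := mkseq (fun k =>
  if odd k then complex.Im (wnth w k./2) else complex.Re (wnth w k./2)) d.*2.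

Lemma size_realif d (w : 'rV[C]_d) : size (realif w) = d.*2.
Proof. by rewrite size_mkseq. Qed.

Lemma realif_sum d (w : 'rV[C]_d) (f : nat -> R) :
  \sum_(i < d.*2) (realif w)`_i * f i = \sum_(i < d)
    (complex.Re (w 0 i) * f i.*2 + complex.Im (w 0 i) * f i.*2.+1).
Proof.
rewrite (sum_double _ (fun i => (realif w)`_i * f i)); apply: eq_bigr => i _.
have id := ltn_ord i.
rewrite !nth_mkseq ?ltn_double//; last by rewrite -doubleS leq_double.
by rewrite /= odd_double/= doubleK uphalf_double wnthE.
Qed.

(** The real part of the Hermitian product is the Euclidean product of [R^{2d}]; this is the link to
    the real moments. *)
Lemma cinner_yvec d s (w : 'rV[C]_d) : size s = d.*2 ->
  cinner (yvec d s) w + (cinner (yvec d s) w)^* = (2 * ydot (realif w) s)%:C.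
Proof.
move=> sd; rewrite addcJ rmorphM rmorph_nat; congr (_ * _%:C).
rewrite cinnerE/= ydotE ?size_realif// sd realif_sum.
by apply: eq_bigr => i _; rewrite !mxE/= ![ycoord _ _ * _]mulrC.
Qed.

Lemma dots_realif d (w : 'rV[C]_d) : dots (realif w) (realif w) = cnorm2 w.
Proof.
rewrite dotsE// size_realif realif_sum /cnorm2 cinnerE/=; apply: eq_bigr => i _.
have id := ltn_ord i.
rewrite !nth_mkseq ?ltn_double//; last by rewrite -doubleS leq_double.
by rewrite /= odd_double/= doubleK uphalf_double wnthE.
Qed.

Lemma b_mE d m : b_m R d.+1 m = (if odd m then 0 else moment1 d.+1.*2 m)%:C.
Proof.
rewrite /b_m; case: ifPn => // em.
rewrite -[in RHS](even_halfK em); move: m./2 => k {m em}.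
have P0 : (\prod_(i < k) (2 * d.+1 + 2 * i))%N%:R != 0 :> C.
  by rewrite pnatr_eq0 -lt0n; apply: prodn_gt0 => i; rewrite addn_gt0 muln_gt0.
apply: (mulIf P0); rewrite divfK//.
rewrite -[in RHS](rmorph_nat (real_complex R)) -rmorphM.
have -> : (\prod_(i < k) (2 * d.+1 + 2 * i))%N = (\prod_(i < k) (d.*2.+2 + i.*2))%N.
  by apply: eq_bigr => i _; lia.
rewrite -[d.+1.*2]/(d.*2.+2) moment1E rmorph_nat; congr _%:R.
by apply: eq_bigr => i _; lia.
Qed.

Lemma sphere_int_real_moment d (w : 'rV[C]_d.+1) m : cinner w w = 1 ->
  sphere_int (fun z => (cinner z w + (cinner z w)^*) ^+ m) = 2 ^+ m * b_m R d.+1 m.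
Proof.
move=> ww; rewrite sphere_intE b_mE.
have E s : size s = d.+1.*2 -> (cinner (yvec d.+1 s) w + (cinner (yvec d.+1 s) w)^*) ^+ m
    = (2 ^+ m * ydot (realif w) s ^+ m)%:C.
  by move=> sd; rewrite cinner_yvec// -rmorphXn exprMn.
rewrite (@eq_mean _ _ _ (fun s => 2 ^+ m * ydot (realif w) s ^+ m)); last first.
  by move=> s sd; rewrite E.
rewrite [X in _ +i* X](@eq_mean _ _ _ (fun=> 0)) ?mean_cst; last first.
  by move=> s sd; rewrite E.
rewrite meanZ; last exact/bdd_measX/bdd_meas_ydot/size_realif.
rewrite -/(moment _ _ _) complexr0 rmorphM rmorphXn rmorph_nat; congr (_ * _%:C).
have [om|em] := boolP (odd m).
  by rewrite -[d.+1.*2]/(d.*2.+2) moment_odd// size_realif.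
rewrite -(even_halfK em) -[d.+1.*2]/(d.*2.+2) moment_even ?size_realif//.
by rewrite dots_realif /cnorm2 ww expr1n mul1r.
Qed.

End ComplexSphere.

(** * Mixed moments of [<z,v>] and its conjugate *)

Section ComplexMoments.
Context {R : realType}.
Notation C := R[i].

Lemma cinnerZr d a (z w : 'rV[C]_d) : cinner z (a *: w) = a^* * cinner z w.
Proof.
by rewrite /cinner mulr_sumr; apply: eq_bigr => i _; rewrite mxE rmorphM mulrCA.
Qed.

Lemma cinnerZl d a (z w : 'rV[C]_d) : cinner (a *: z) w = a * cinner z w.
Proof.
by rewrite /cinner mulr_sumr; apply: eq_bigr => i _; rewrite mxE mulrA.
Qed.

Lemma cbdd_meas_cinner d (w : 'rV[C]_d) : cbdd_meas (fun z => cinner z w).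
Proof. by apply: cbdd_meas_sum => i _; apply: cbdd_measM; [exact: cbdd_meas_coord|exact: cbdd_meas_cst]. Qed.

(** A Cayley transform: it supplies infinitely many distinct points of the unit circle by field
    operations alone. *)
Definition circle_pt (t : nat) : C := (1 +i* t%:R) / (1 -i* t%:R).

Lemma circle_ptK t : circle_pt t * (circle_pt t)^* = 1.
Proof.
have n0 b : (1 +i* b : C) != 0 by rewrite eq_complex/= oner_eq0.
have -> : (circle_pt t)^*%R = (1 -i* t%:R) / (1 +i* t%:R).
  rewrite /circle_pt rmorphM fmorphV; congr (_ / _).
  by apply/eqP; rewrite eq_complex/= opprK !eqxx.
by rewrite /circle_pt mulrA divfK// divff.
Qed.

Lemma circle_pt_inj : injective circle_pt.
Proof.
move=> t t' /eqP; have n0 a : (1 +i* a : C) != 0 by rewrite eq_complex/= oner_eq0.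
rewrite eqr_div// => /eqP[_]; rewrite !mul1r !mulr1 => e.
by apply/eqP; rewrite -(eqr_nat R); apply/eqP; lra.
Qed.

(* On the unit circle [(a^* x + a x^* )^m a^m] is a polynomial in [a] whose
   coefficients are the wanted moments. *)
Lemma sphere_int_moment_coef d (v : 'rV[C]_d.+1) m l : cinner v v = 1 -> (l <= m)%N ->
  sphere_int (fun z => cinner z v ^+ (m - l) * (cinner z v)^* ^+ l) *+ 'C(m, l) =
  (2 ^+ m * b_m R d.+1 m) *+ (l.*2 == m).
Proof.
move=> vv lm; set c := 2 ^+ m * _.
pose f i := fun z : 'rV[C]_d.+1 => cinner z v ^+ (m - i) * (cinner z v)^* ^+ i.
have fA i : cbdd_meas (f i).
  by apply: cbdd_measM; apply: cbdd_measX; [|apply: cbdd_measJ]; exact: cbdd_meas_cinner.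
pose p : {poly C} := \sum_(i < m.+1) (sphere_int (f i) *+ 'C(m, i)) *: 'X^(i.*2).
pose q : {poly C} := c *: 'X^m.
have pq : p = q.
  apply: (@poly_eq_on_seq _ p q _ circle_pt_inj) => t; move: (circle_pt t) (circle_ptK t) => a aa.
  (* Since [a v] is again a unit vector, its real moment is the same constant [c] for every such
     [a]. *)
  have avv : cinner (a *: v) (a *: v) = 1 by rewrite cinnerZl cinnerZr vv mulr1.
  rewrite /q hornerZ hornerXn -[c](sphere_int_real_moment m avv) horner_sum.
  rewrite (@eq_sphere_int _ _ _ (fun z => \sum_(i < m.+1)
      (a^* ^+ (m - i) * a ^+ i) *+ 'C(m, i) * f i z)); last first.
    move=> z; rewrite cinnerZr rmorphM/= conjCK exprDn; apply: eq_bigr => i _.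
    by rewrite !exprMn mulrACA mulrnAl.
  rewrite sphere_int_sum => [|i _]; last by apply: cbdd_measM => //; exact: cbdd_meas_cst.
  rewrite mulr_suml; apply: eq_bigr => i _.
  rewrite hornerZ hornerXn sphere_intZ// !mulrnAl; congr (_ *+ _).
  have im : (i <= m)%N by rewrite -ltnS.
  rewrite mulrC [X in _ = X * _]mulrC -mulrA mulrC; congr (_ * _).
  have -> : a ^+ m = a ^+ (m - i) * a ^+ i by rewrite -exprD subnK.
  transitivity ((a * a^*) ^+ (m - i) * a ^+ i.*2); first by rewrite aa expr1n mul1r.
  by rewrite exprMn -addnn exprD; ring.
have := congr1 (fun r : {poly C} => r`_(l.*2)) pq.
rewrite /p /q coefZ coefXn mulr_natr coef_sum => <-.
have lm' : (l < m.+1)%N by rewrite ltnS.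
rewrite (bigD1 (Ordinal lm'))//= coefZ coefXn eqxx mulr1 big1 ?addr0// => i il.
rewrite coefZ coefXn (inj_eq double_inj) (_ : (l == i) = false) ?mulr0//.
by apply: contraNF il => /eqP li; apply/eqP/val_inj.
Qed.

(** With denominators cleared, three facts remain: a power of 2 comes out of a product of even
    numbers, [(2p)!] splits into even and odd factors, and the central binomial coefficient is a
    quotient of factorials. *)
Lemma b_pp_bm d p : b_pq R d.+1 p p *+ 'C(p.*2, p) = 2 ^+ p.*2 * b_m R d.+1 p.*2.
Proof.
rewrite /b_pq eqxx /b_m odd_double doubleK -[in RHS]natrX mulrA -natrM.
rewrite -[_ *+ _]mulr_natr mulrAC -natrM /=.
have F0 : ((d + p)`!)%:R != 0 :> C by rewrite pnatr_eq0 -lt0n fact_gt0.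
have P0 : (\prod_(i < p) (2 * d.+1 + 2 * i))%N%:R != 0 :> C.
  by rewrite pnatr_eq0 -lt0n; apply: prodn_gt0 => i; rewrite addn_gt0 muln_gt0.
apply/eqP; rewrite eqr_div// -!natrM eqr_nat; apply/eqP.
have e1 : (d`! * \prod_(i < p) (2 * d.+1 + 2 * i) = 2 ^ p * (d + p)`!)%N.
  elim: p {F0 P0} => [|p IH]; first by rewrite big_ord0 addn0 muln1 mul1n.
  by rewrite big_ord_recr/= mulnA IH addnS factS expnS; move: (2 ^ p)%N (_`!) => a b; nia.
have e2 : (2 ^ p * p`! * \prod_(i < p) (2 * i + 1) = (p.*2)`!)%N.
  elim: p {F0 P0 e1} => [|p IH]; first by rewrite big_ord0.
  rewrite big_ord_recr/= doubleS !factS -IH expnS.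
  by move: (2 ^ p)%N (_`!) (\prod_(i < p) _)%N => a b c; nia.
have e3 : ('C(p.*2, p) * (p`! * p`!) = (p.*2)`!)%N.
  by have := bin_fact (leq_addr p p); rewrite addnK addnn.
have p0 := fact_gt0 p.
apply/eqP; rewrite -(eqn_pmul2r p0); apply/eqP.
transitivity ((d`! * \prod_(i < p) (2 * d.+1 + 2 * i)) * ('C(p.*2, p) * (p`! * p`!)))%N.
  by ring.
by rewrite e1 e3 -e2 -muln2 expnM; ring.
Qed.

(** Take [m = p + q] and [l = q] in the coefficient comparison: [2l = m] says exactly [p = q], and
    the positive binomial coefficient cancels. *)
Lemma sphere_int_complex_moment d (v : 'rV[C]_d.+1) p q : cinner v v = 1 ->
  sphere_int (fun z => cinner z v ^+ p * (cinner z v)^* ^+ q) = b_pq R d.+1 p q.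
Proof.
move=> vv.
have := sphere_int_moment_coef vv (leq_addl p q); rewrite addnK => E.
have C0 : (0 < 'C(p + q, q))%N by rewrite bin_gt0 leq_addl.
apply/eqP; rewrite -(eqr_pMn2r C0) E -addnn eqn_add2r eq_sym; apply/eqP.
have [->|pq] := eqVneq p q; first by rewrite mulr1n addnn b_pp_bm.
by rewrite /b_pq (negbTE pq) mulr0n mul0rn.
Qed.

End ComplexMoments.

(** * Potentials *)

Section Potentials.
Context {R : realType}.
Notation C := R[i].

Lemma sphere_intJ d (f : 'rV[C]_d -> C) : cbdd_meas f ->
  sphere_int (fun z => (f z)^*%R) = (sphere_int f)^*%R.
Proof.
move=> [fr fi]; rewrite !sphere_intE; apply/eqP; rewrite eq_complex/=.
apply/andP; split; apply/eqP; first by apply: eq_mean => s _; rewrite ReJ.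
by rewrite -mulN1r -meanZ//; apply: eq_mean => s _; rewrite ImJ.
Qed.

Lemma cinnerJ d (z w : 'rV[C]_d) : (cinner z w)^*%R = cinner w z.
Proof.
by rewrite /cinner rmorph_sum; apply: eq_bigr => i _; rewrite rmorphM/= conjCK mulrC.
Qed.

(* With [L a] the integral of the monomial [mon a] and [T a] its weighted sum
   over the [v j], the energy equals [kappa * \sum_a |T a - L a|^2]. *)
Lemma kernel_potential d (I : finType) (mon : I -> 'rV[C]_d.+1 -> C) (kappa beta : C)
    (K : 'rV[C]_d.+1 -> 'rV[C]_d.+1 -> C) (F : C -> C)
    (P : ('rV[C]_d.+1 -> C) -> Prop) :
  0 < kappa ->
  (forall a, cbdd_meas (mon a)) ->
  (forall z w, K z w = \sum_a mon a z * (mon a w)^*) ->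
  (forall v, cinner v v = 1 -> sphere_int (K^~ v) = beta) ->
  (forall z w, F (cinner z w) = kappa * (K z w - beta)) ->
  (forall f, P f <-> exists c : I -> C, forall z, f z = \sum_a c a * mon a z) ->
  gives_potential F P.
Proof.
move=> k0 monA KE Kbeta FE PE n v w vv w1 /=.
pose L a := sphere_int (mon a).
pose T a := \sum_(j < n) (w j)%:C * mon a (v j).
have cA c a : cbdd_meas (fun z => c * mon a z) by apply: cbdd_measM => //; exact: cbdd_meas_cst.
have E1 u : cinner u u = 1 -> \sum_a L a * (mon a u)^* = beta.
  move=> /Kbeta <-; rewrite (eq_sphere_int (g := fun z => \sum_a (mon a u)^* * mon a z)).
    by rewrite sphere_int_sum//; apply: eq_bigr => a _; rewrite sphere_intZ// mulrC.
  by move=> z; rewrite KE; apply: eq_bigr => a _; rewrite mulrC.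
(* Integrate [E1] over [u]; it holds only for unit [u], which is enough on the sphere. *)
have E2 : \sum_a L a * (L a)^* = beta.
  rewrite -[RHS](@sphere_int_cst _ d.+1).
  rewrite -(@sphere_int_unit _ _ (fun z => \sum_a L a * (mon a z)^*)).
  - rewrite sphere_int_sum => [|a _].
      by apply: eq_bigr => a _; rewrite sphere_intZ ?sphere_intJ//; exact: cbdd_measJ.
    by apply: cbdd_measM; [exact: cbdd_meas_cst|exact: cbdd_measJ].
  - by apply: cbdd_meas_sum => a _; apply: cbdd_measM; [exact: cbdd_meas_cst|exact: cbdd_measJ].
  - exact: cbdd_meas_cst.
  - exact: E1.
(* By [E2], [beta] is a sum of squared moduli, hence real. *)
have betaJ : beta^*%R = beta.
  rewrite -E2 rmorph_sum; apply: eq_bigr => a _.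
  by rewrite rmorphM/= conjCK mulrC.
have w1C : \sum_(j < n) (w j)%:C = 1 :> C by rewrite -rmorph_sum w1.
have TJ a : (T a)^*%R = \sum_(j < n) (w j)%:C * (mon a (v j))^*.
  rewrite /T rmorph_sum; apply: eq_bigr => j _; rewrite rmorphM/=; congr (_ * _).
  exact: conjc_real.
have E3 : \sum_a L a * (T a)^* = beta.
  transitivity (\sum_(j < n) (w j)%:C * beta); last by rewrite -mulr_suml w1C mul1r.
  under eq_bigr => a _ do rewrite TJ mulr_sumr.
  rewrite exchange_big/=; apply: eq_bigr => j _.
  by rewrite -(E1 _ (vv j)) mulr_sumr; apply: eq_bigr => a _; rewrite mulrCA.
have E4 : \sum_a T a * (L a)^* = beta.
  rewrite -[RHS]betaJ -E3 rmorph_sum; apply: eq_bigr => a _.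
  by rewrite rmorphM/= conjCK mulrC.
have E5 : \sum_a T a * (T a)^* =
    \sum_(j < n) \sum_(k < n) (w j)%:C * (w k)%:C * K (v j) (v k).
  under eq_bigr => a _ do rewrite TJ mulr_suml.
  rewrite exchange_big/=; apply: eq_bigr => j _.
  under eq_bigr => a _ do rewrite mulr_sumr.
  rewrite exchange_big/=; apply: eq_bigr => k _.
  by rewrite KE mulr_sumr; apply: eq_bigr => a _; rewrite mulrACA.
set S := \sum_(j < n) _.
(* Expanding the squares, both cross sums and the sum of [|L a|^2] equal [beta], so the net
   correction to the sum of [|T a|^2] is [-beta]. *)
have SE : S = kappa * \sum_a `|T a - L a| ^+ 2.
  transitivity (kappa * (\sum_a T a * (T a)^* - beta)).
    rewrite E5 mulrBr mulr_sumr.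
    have -> : kappa * beta = \sum_(j < n) \sum_(k < n) (w j)%:C * (w k)%:C * (kappa * beta).
      under eq_bigr => j _ do rewrite -mulr_suml -mulr_sumr w1C mulr1.
      by rewrite -mulr_suml w1C mul1r.
    rewrite -sumrB; apply: eq_bigr => j _; rewrite mulr_sumr -sumrB.
    by apply: eq_bigr => k _; rewrite FE; ring.
  congr (_ * _).
  transitivity (\sum_a (T a * (T a)^* - T a * (L a)^* - L a * (T a)^* + L a * (L a)^*)).
    by rewrite big_split/= !sumrB E2 E3 E4 subrK.
  by apply: eq_bigr => a _; rewrite normCK rmorphB/=; ring.
have N0 a : 0 <= `|T a - L a| ^+ 2 by rewrite exprn_ge0.
split; first by rewrite SE mulr_ge0 ?sumr_ge0// ltW.
have -> : S = 0 <-> forall a, L a = T a.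
  rewrite SE; split => [/eqP|LT]; last first.
    by rewrite big1 ?mulr0// => a _; rewrite LT subrr normr0 expr0n.
  rewrite mulf_eq0 gt_eqF//= psumr_eq0// => /allP S0 a.
  have := S0 a (mem_index_enum a); rewrite /= expf_eq0/= normr_eq0 subr_eq0.
  by move=> /eqP ->.
split => [LT f /PE[c fc]|SI a].
  rewrite (eq_sphere_int fc) sphere_int_sum//.
  transitivity (\sum_a c a * T a).
    by apply: eq_bigr => a _; rewrite sphere_intZ// -/(L a) LT.
  under [LHS]eq_bigr => a _ do rewrite /T/= mulr_sumr.
  rewrite exchange_big/=; apply: eq_bigr => j _.
  by rewrite fc mulr_sumr; apply: eq_bigr => a _; rewrite mulrCA.
(* Each monomial belongs to [P], with Kronecker coefficients, so exactness on [P] gives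
   [L a = T a]. *)
apply: SI; apply/PE; exists (fun b => (b == a)%:R) => z.
rewrite (bigD1 a)//= eqxx mul1r big1 ?addr0// => b /negbTE ->.
by rewrite mul0r.
Qed.

(** Indexing by words instead of exponents repeats monomials but avoids multinomial coefficients,
    and matches the encoding of [Hom_pq] and [Hom_m]. *)
Lemma expr_sum_ffun (I : finType) m (f : I -> C) :
  (\sum_i f i) ^+ m = \sum_(a : {ffun 'I_m -> I}) \prod_(k < m) f (a k).
Proof. by rewrite -(bigA_distr_bigA (fun _ i => f i)) prodr_const card_ord. Qed.

Lemma Hom_pq_potential d p q :
  gives_potential (fun z : C => z ^+ p * z^* ^+ q - b_pq R d.+1 p q)
    (@Hom_pq R d.+1 p q).
Proof.
pose I := ({ffun 'I_p -> 'I_d.+1} * {ffun 'I_q -> 'I_d.+1})%type.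
pose mon (a : I) (z : 'rV[C]_d.+1) : C :=
  (\prod_(k < p) z 0 (a.1 k)) * (\prod_(l < q) (z 0 (a.2 l))^*).
apply: (@kernel_potential d I mon 1 (b_pq R d.+1 p q)
  (fun z w => cinner z w ^+ p * (cinner z w)^* ^+ q)) => //.
- move=> a; apply: cbdd_measM; apply: cbdd_meas_prod => k _; last apply: cbdd_measJ; exact: cbdd_meas_coord.
- move=> z w; rewrite cinnerJ /cinner.
  rewrite !expr_sum_ffun big_distrlr/= pair_big/=; apply: eq_bigr => a _.
  rewrite /mon rmorphM !rmorph_prod mulrACA -!big_split/=; congr (_ * _).
  by apply: eq_bigr => l _; rewrite conjCK mulrC.
- by move=> v vv; rewrite sphere_int_complex_moment.
- by move=> z w; rewrite mul1r.
- move=> f; split => [[c fc]|[c fc]].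
    exists (fun a => c a.1 a.2) => z; rewrite fc pair_big/=.
    by apply: eq_bigr => a _; rewrite mulrA.
  exists (fun a b => c (a, b)) => z; rewrite fc pair_big/=.
  by apply: eq_bigr => -[a b] _; rewrite /mon mulrA.
Qed.

Lemma Re_cinner d (z w : 'rV[C]_d) :
  'Re (cinner z w) = \sum_(r : 'I_d * bool) real_coord z r * real_coord w r.
Proof.
rewrite -complexRe cinnerE/= rmorph_sum/=.
rewrite -(pair_bigA _ (fun i b => real_coord z (i, b) * real_coord w (i, b)))/=.
apply: eq_bigr => i _; rewrite big_bool /real_coord/=.
by rewrite -!complexRe -!complexIm rmorphD !rmorphM.
Qed.

Lemma Hom_m_potential d m :
  gives_potential (fun z : C => (z + z^*) ^+ m - 2 ^+ m * b_m R d.+1 m) (@Hom_m R d.+1 m).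
Proof.
pose mon (a : {ffun 'I_m -> 'I_d.+1 * bool}) (z : 'rV[C]_d.+1) : C :=
  \prod_(k < m) real_coord z (a k).
have coordJ (z : 'rV[C]_d.+1) r : (real_coord z r)^*%R = real_coord z r.
  by apply/CrealP; rewrite /real_coord; case: r.2; rewrite ?Creal_Re ?Creal_Im.
have addJ (z : C) : z + z^* = 2 * 'Re z by rewrite addcJ complexRe.
apply: (@kernel_potential d _ mon (2 ^+ m) (b_m R d.+1 m)
  (fun z w => 'Re (cinner z w) ^+ m)) => //.
- move=> a; apply: cbdd_meas_prod => k _; rewrite /real_coord.
  case: (a k) => i [] /=; have ci := cbdd_meas_coord i.
    split.
      by under eq_fun do rewrite -complexRe/= mxE/=; exact: bdd_meas_ycoord.
    by under eq_fun do rewrite -complexRe/=; exact: bdd_meas_cst.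
  split.
    by under eq_fun do rewrite -complexIm/= mxE/=; exact: bdd_meas_ycoord.
  by under eq_fun do rewrite -complexIm/=; exact: bdd_meas_cst.
- move=> z w; rewrite Re_cinner expr_sum_ffun; apply: eq_bigr => a _.
  rewrite /mon rmorph_prod -big_split/=; apply: eq_bigr => k _.
  by rewrite coordJ.
(* The kernel is the [m]-th power of [Re <z,v>], whose integral is the known moment of [2 Re <z,v>]
   divided by [2^m]; this explains the choice [kappa = 2^m]. *)
- move=> v vv; have two0 : 2 ^+ m != 0 :> C by rewrite expf_neq0// pnatr_eq0.
  apply: (mulfI two0); rewrite -(sphere_int_real_moment m vv).
  rewrite (eq_sphere_int (g := fun z => (2 ^+ m)^-1 * (cinner z v + (cinner z v)^*) ^+ m)).
    rewrite sphere_intZ ?mulrA ?divff ?mul1r//.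
    apply: cbdd_measX; apply: cbdd_measD; last apply: cbdd_measJ; exact: cbdd_meas_cinner.
  by move=> z; rewrite addJ exprMn mulKf.
- by move=> z w; rewrite addJ exprMn mulrBr.
Qed.

End Potentials.

Theorem theorem5p7 (R : realType) (d p q : nat) :
  (1 <= d)%N ->
  gives_potential (fun z : R[i] => z ^+ p * z^* ^+ q - b_pq R d p q)
                  (@Hom_pq R d p q)
  /\
  (forall m : nat, (1 <= m)%N ->
     (forall z : R[i],
        (z + z^*) ^+ m - 2 ^+ m * b_m R d m = 2 ^+ m * ('Re z ^+ m - b_m R d m))
     /\
     gives_potential (fun z : R[i] => (z + z^*) ^+ m - 2 ^+ m * b_m R d m)
                     (@Hom_m R d m)).
Proof.
case: d => // d _; split; first exact: Hom_pq_potential.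
move=> m _; split; last exact: Hom_m_potential.
by move=> z; rewrite addcJ complexRe exprMn mulrBr.
Qed.
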